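(* Let $\mathcal H$ be a finite-dimensional complex Hilbert space, let $\Theta$ be an open subset of $\mathbb R^k$, and let $\rho:\Theta\to\mathcal S(\mathcal H)$ be a twice differentiable parametric family of states on $\mathcal H$. Suppose that (i) there is a measurement $M$ on $\mathcal H$ with $i(\theta;M)=I(\theta)$ (equality of $k\times k$ matrices) for all $\theta\in\Theta$; (ii) $\rho(\theta)$ is strictly positive for all $\theta\in\Theta$; (iii) $\Theta$ is simply connected. Then, for any $\theta_0\in\Theta$, there are an observable (self-adjoint operator) $X$ on $\mathcal H$ and a real-valued function $F$ on $\mathbb R\times\Theta$ (possibly depending on $\theta_0$) such that, for all $\theta\in\Theta$, $$\rho(\theta)=\exp\{\tfrac12F(X;\theta)\}\,\rho(\theta_0)\,\exp\{\tfrac12F(X;\theta)\}.$$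
   Context: $\mathcal S(\mathcal H)$ denotes the set of states on $\mathcal H$, i.e. non-negative self-adjoint operators of trace $1$. A measurement $M$ with outcome space a measurable space $(\mathcal X,\mathcal A)$ is a countably additive map $A\mapsto M(A)$ from $\mathcal A$ into the non-negative self-adjoint operators on $\mathcal H$ with $M(\mathcal X)=\mathbf 1$. Since $\mathcal H$ is finite-dimensional, $M$ has a density $m$ with respect to a $\sigma$-finite measure $\nu$: $M(A)=\int_Am(x)\,\nu(\mathrm dx)$, with $m(x)$ self-adjoint and non-negative. When the state is $\rho(\theta)$, the outcome has density $p(x;\theta)=\mathrm{tr}\{\rho(\theta)m(x)\}$ with respect to $\nu$. The quantum scores $\rho_{/\!\!/1}(\theta),\dots,\rho_{/\!\!/k}(\theta)$ are the self-adjoint solutions (unique if $\rho(\theta)$ is strictly positive) of $\frac{\partial}{\partial\theta^j}\rho=\frac12(\rho\,\rho_{/\!\!/j}+\rho_{/\!\!/j}\,\rho)$. The quantum information matrix is $$I(\theta)_{jl}=\tfrac12\mathrm{tr}\{\rho_{/\!\!/j}(\theta)\rho(\theta)\rho_{/\!\!/l}(\theta)+\rho_{/\!\!/l}(\theta)\rho(\theta)\rho_{/\!\!/j}(\theta)\}.$$ The Fisher information matrix in the outcome of $M$ is $i(\theta;M)_{jl}=\mathrm E_\theta[l_{/j}(\theta)l_{/l}(\theta)]$, where, on $\{x:p(x;\theta)>0\}$, $l_{/j}(\theta)=p(x;\theta)^{-1}\mathrm{tr}\{\frac{\partial\rho}{\partial\theta^j}(\theta)\,m(x)\}$ is the partial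 derivative of the log likelihood $\log p(x;\theta)$, and $\mathrm E_\theta$ is expectation under the density $p(\cdot;\theta)$. If $X=\sum_xx\,\Pi_{[X=x]}$ is the spectral decomposition of $X$, then $F(X;\theta)=\sum_xF(x;\theta)\Pi_{[X=x]}$. *)

(* Defs.v *)
From HB Require Import structures.
From mathcomp Require Export all_boot all_order all_algebra.
From mathcomp Require Export spectral complex.
From mathcomp Require Export all_classical all_reals all_analysis.

Set Implicit Arguments.
Unset Strict Implicit.
Unset Printing Implicit Defensive.

Export numFieldNormedType.Exports.
Import Order.TTheory GRing.Theory Num.Theory.

Local Open Scope classical_set_scope.
Local Open Scope complex_scope.
Local Open Scope ring_scope.

(* The Hilbert space is C^n with its standard inner product, and an operator
   is its matrix in the standard basis.  A matrix acts on row vectors by right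
   multiplication, following mathcomp's eigenspace and proj_ortho; a
   self-adjoint matrix is sum_x x *: P_x for the same projections P_x whether
   it acts on rows or on columns. *)

(* R[i] carries no normed module structure over R, so limits, derivatives and
   integrals of complex matrices are taken on real and imaginary parts. *)
Definition remx (R : realType) (m n : nat) (A : 'M[R[i]]_(m, n)) :
  'M[R]_(m, n) := map_mx (@complex.Re R) A.

Definition immx (R : realType) (m n : nat) (A : 'M[R[i]]_(m, n)) :
  'M[R]_(m, n) := map_mx (@complex.Im R) A.

Definition cplxmx (R : realType) (m n : nat) (A B : 'M[R]_(m, n)) :
  'M[R[i]]_(m, n) := \matrix_(a, b) (A a b +i* B a b).

(* The order of R[i] makes 0 <= z and 0 < z entail that z is real. *)
Definition nonneg_op (R : realType) (n : nat) (A : 'M[R[i]]_n) : Prop :=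
  A \is hermsymmx /\ forall u : 'rV[R[i]]_n, 0 <= dotmx (u *m A) u.

Definition strictly_pos_op (R : realType) (n : nat) (A : 'M[R[i]]_n) : Prop :=
  A \is hermsymmx /\
  forall u : 'rV[R[i]]_n, u != 0 -> 0 < dotmx (u *m A) u.

Definition is_state (R : realType) (n : nat) (A : 'M[R[i]]_n) : Prop :=
  nonneg_op A /\ \tr A = 1.

Definition mx_differentiable (R : realType) (k n : nat)
    (f : 'rV[R]_k -> 'M[R[i]]_n) (x : 'rV[R]_k) : Prop :=
  differentiable (fun y => remx (f y)) x /\ differentiable (fun y => immx (f y)) x.

Definition mx_partial (R : realType) (k n : nat)
    (f : 'rV[R]_k -> 'M[R[i]]_n) (j : 'I_k) (x : 'rV[R]_k) : 'M[R[i]]_n :=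
  cplxmx ('D_(delta_mx 0 j) (fun y => remx (f y)) x)
         ('D_(delta_mx 0 j) (fun y => immx (f y)) x).

(* Frechet differentiability of f and of its derivative; the latter amounts to
   differentiability of every partial derivative. *)
Definition twice_differentiable_on (R : realType) (k n : nat)
    (D : set 'rV[R]_k) (f : 'rV[R]_k -> 'M[R[i]]_n) : Prop :=
  forall x, D x -> mx_differentiable f x /\
    forall j : 'I_k, mx_differentiable (mx_partial f j) x.

Definition is_qscore (R : realType) (k n : nat)
    (rho : 'rV[R]_k -> 'M[R[i]]_n) (j : 'I_k) (theta : 'rV[R]_k)
    (L : 'M[R[i]]_n) : Prop :=
  L \is hermsymmx /\
  mx_partial rho j theta = 2^-1 *: (rho theta *m L + L *m rho theta).

(* A chosen solution: it is the unique one when rho theta is strictly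
   positive.  The default value 0 is used only if there is no solution. *)
Definition qscore (R : realType) (k n : nat)
    (rho : 'rV[R]_k -> 'M[R[i]]_n) (j : 'I_k) (theta : 'rV[R]_k) :
  'M[R[i]]_n := xget 0 [set L | is_qscore rho j theta L].

Definition qinfo (R : realType) (k n : nat)
    (rho : 'rV[R]_k -> 'M[R[i]]_n) (theta : 'rV[R]_k) : 'M[R[i]]_k :=
  \matrix_(j, l) (2^-1 * \tr (
    qscore rho j theta *m rho theta *m qscore rho l theta +
    qscore rho l theta *m rho theta *m qscore rho j theta)).

(* Taking F constantly set0 in the last clause forces M set0 = 0. *)
Definition is_measurement (R : realType) (n : nat) (d : measure_display)
    (T : measurableType d) (M : set T -> 'M[R[i]]_n) : Prop :=
  [/\ forall A, measurable A -> nonneg_op (M A),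
      M [set: T] = 1%:M &
      forall F : nat -> set T, (forall i, measurable (F i)) ->
        trivIset [set: nat] F ->
        (fun N => remx (\sum_(i < N) M (F i))) @ \oo -->
          remx (M (\bigcup_i F i)) /\
        (fun N => immx (\sum_(i < N) M (F i))) @ \oo -->
          immx (M (\bigcup_i F i))].

Definition is_density (R : realType) (n : nat) (d : measure_display)
    (T : measurableType d) (nu : {sigma_finite_measure set T -> \bar R})
    (m : T -> 'M[R[i]]_n) (M : set T -> 'M[R[i]]_n) : Prop :=
  [/\ forall x, nonneg_op (m x),
      forall a b, nu.-integrable [set: T] (fun x => (remx (m x) a b)%:E) /\
                  nu.-integrable [set: T] (fun x => (immx (m x) a b)%:E) &
      forall A, measurable A ->
        M A = cplxmx (\matrix_(a, b) \int[nu]_(x in A) remx (m x) a b)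
                     (\matrix_(a, b) \int[nu]_(x in A) immx (m x) a b)].

(* The traces below are real: both factors are self-adjoint. *)
Definition likelihood (R : realType) (k n : nat) (T : Type)
    (rho : 'rV[R]_k -> 'M[R[i]]_n) (m : T -> 'M[R[i]]_n)
    (theta : 'rV[R]_k) (x : T) : R :=
  complex.Re (\tr (rho theta *m m x)).

Definition score (R : realType) (k n : nat) (T : Type)
    (rho : 'rV[R]_k -> 'M[R[i]]_n) (m : T -> 'M[R[i]]_n)
    (j : 'I_k) (theta : 'rV[R]_k) (x : T) : R :=
  (likelihood rho m theta x)^-1 *
  complex.Re (\tr (mx_partial rho j theta *m m x)).

(* If the rho theta are strictly positive states, the integrands are
   integrable (Cauchy-Schwarz with the quantum scores), so that the integrals
   have their usual meaning. *)
Definition fisher_info (R : realType) (k n : nat) (d : measure_display)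
    (T : measurableType d) (nu : {sigma_finite_measure set T -> \bar R})
    (rho : 'rV[R]_k -> 'M[R[i]]_n) (m : T -> 'M[R[i]]_n)
    (theta : 'rV[R]_k) : 'M[R]_k :=
  \matrix_(j, l) \int[nu]_(x in [set x | 0 < likelihood rho m theta x])
    (score rho m j theta x * score rho m l theta x *
     likelihood rho m theta x).

Definition is_path_in (R : realType) (k : nat) (D : set 'rV[R]_k)
    (x y : 'rV[R]_k) (g : R -> 'rV[R]_k) : Prop :=
  [/\ {within `[0, 1], continuous g}, g 0 = x, g 1 = y &
      forall t : R, 0 <= t <= 1 -> D (g t)].

(* Path connected, and every loop is homotopic to a point in D with fixed base
   point. *)
Definition simply_connected (R : realType) (k : nat) (D : set 'rV[R]_k) :
  Prop :=
  (forall x y, D x -> D y -> exists g, is_path_in D x y g) /\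
  (forall x g, is_path_in D x x g ->
    exists H : R * R -> 'rV[R]_k,
      [/\ {within `[0, 1] `*` `[0, 1], continuous H},
          forall s t : R, 0 <= s <= 1 -> 0 <= t <= 1 -> D (H (s, t)),
          forall t : R, 0 <= t <= 1 -> H (0, t) = g t,
          forall t : R, 0 <= t <= 1 -> H (1, t) = x &
          forall s : R, 0 <= s <= 1 -> H (s, 0) = x /\ H (s, 1) = x]).

Definition op_fun (R : realType) (n : nat) (f : R -> R) (X : 'M[R[i]]_n) :
  'M[R[i]]_n :=
  \sum_(x \in [set x : R | eigenvalue X x%:C])
    (f x)%:C *: proj_ortho (eigenspace X x%:C).

Definition expmx (R : realType) (n : nat) (A : 'M[R[i]]_n) : 'M[R[i]]_n :=
  let S N := \sum_(i < N) (i`!%:R)^-1 *: A ^+ i in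
  cplxmx (limn (fun N => remx (S N))) (limn (fun N => immx (S N))).

(* Main.v *)
(* If L is a quantum score, the state rho is positive and m(x) >= 0, then for
   real l the trace of rho (L - l) m(x) (L - l) is non-negative and vanishes
   only if L m(x) = l m(x).  Taking l to be the classical score and integrating
   shows that the Fisher information is at most the quantum information, and
   that equality forces L m(x) = l(x) m(x) for almost all x.  Two scores L, L',
   possibly at different parameters, then satisfy (L L' - L' L) m(x) = 0 almost
   everywhere, and integrating over x shows that they commute.  So one unitary P
   diagonalizes all scores.  In that basis the score equation reads
   d_j rho_ab = (l_a + l_b) rho_ab / 2; its diagonal part makes l_a the partial
   derivative of ln rho_aa, so rho_ab / sqrt (rho_aa rho_bb) has zero gradient
   and is constant on the connected set Theta. *)
Require Import Defs.
From mathcomp Require Import measurable_realfun ring.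
Import Order.TTheory GRing.Theory Num.Theory.

Set Implicit Arguments.
Unset Strict Implicit.
Unset Printing Implicit Defensive.

Local Open Scope classical_set_scope.
Local Open Scope complex_scope.
Local Open Scope sesquilinear_scope.
Local Open Scope ring_scope.

(** * Unitary conjugation and spectral decompositions *)

Section UnitaryConjugation.
Variables (C : numClosedFieldType) (n : nat).
Implicit Types A B P : 'M[C]_n.

Lemma adjmxM m p q (A : 'M[C]_(m, p)) (B : 'M[C]_(p, q)) :
  (A *m B)^t* = B^t* *m A^t*.
Proof. by rewrite trmx_mul map_mxM. Qed.

Lemma uconjK P A : P \is unitarymx -> P^t* *m (P *m A *m P^t*) *m P = A.
Proof.
move=> PU; have PP := mulmx1C (unitarymxP PU).
by rewrite !mulmxA PP mul1mx -mulmxA PP mulmx1.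
Qed.

Lemma mul_uconj P A B : P \is unitarymx ->
  P^t* *m A *m P *m (P^t* *m B *m P) = P^t* *m (A *m B) *m P.
Proof. by move=> PU; rewrite !mulmxA (mulmxtVK _ PU). Qed.

Lemma uconjD P A B :
  P^t* *m A *m P + P^t* *m B *m P = P^t* *m (A + B) *m P.
Proof. by rewrite mulmxDr mulmxDl. Qed.

Lemma uconjZ P c A : c *: (P^t* *m A *m P) = P^t* *m (c *: A) *m P.
Proof. by rewrite -scalemxAr scalemxAl. Qed.

(** Lets the equation be solved entrywise in the eigenbasis of its coefficient and then transported
    back by [P]. *)
Lemma lyapunov_uconj P D K A : P \is unitarymx ->
  D *m K + K *m D = 2 *: (P *m A *m P^t*) ->
  A = 2^-1 *: (P^t* *m D *m P *m (P^t* *m K *m P) +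
               P^t* *m K *m P *m (P^t* *m D *m P)).
Proof.
move=> PU DK; rewrite !mul_uconj // uconjD DK uconjZ scalerA.
by rewrite mulVf ?scale1r ?uconjK // pnatr_eq0.
Qed.

End UnitaryConjugation.

Section UnitaryDiagonal.
Variables (R : realType) (n : nat).
Implicit Types (A B L P : 'M[R[i]]_n) (d : 'rV[R]_n).

Lemma hermsymmxP A : reflect (A^t* = A) (A \is hermsymmx).
Proof.
by apply: (iffP (is_hermitianmxP _ _ _)); rewrite expr0 scale1r => /esym.
Qed.

Lemma adjmx_unitary P : P \is unitarymx -> P^t* *m P = 1%:M.
Proof. by move=> /unitarymxP/mulmx1C. Qed.

Definition realdiag d : 'M[R[i]]_n := diag_mx (map_mx (real_complex R) d).

Lemma adj_realdiag d : (realdiag d)^t* = realdiag d.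
Proof.
rewrite /realdiag tr_diag_mx map_diag_mx -map_mx_comp; congr diag_mx.
by apply/rowP => j; rewrite !mxE /= -[RHS]conjc_real.
Qed.

Lemma realdiagE d a b : realdiag d a b = (d 0 a *+ (a == b))%:C.
Proof. by rewrite !mxE; case: eqP => // _; rewrite mulr0n. Qed.

Lemma mul_realdiagl m d (B : 'M[R[i]]_(n, m)) a b :
  (realdiag d *m B) a b = (d 0 a)%:C * B a b.
Proof. by rewrite mul_diag_mx !mxE. Qed.

Lemma mul_realdiagr m d (B : 'M[R[i]]_(m, n)) a b :
  (B *m realdiag d) a b = B a b * (d 0 b)%:C.
Proof. by rewrite mul_mx_diag !mxE. Qed.

(** A spectral decomposition: for unitary [P], the rows of [P] are orthonormal eigenvectors and [d]
    lists the real eigenvalues with multiplicity. *)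
Definition udiag P d : 'M[R[i]]_n := P^t* *m realdiag d *m P.

Lemma herm_udiag P d : udiag P d \is hermsymmx.
Proof. by apply/hermsymmxP; rewrite !adjmxM trmxCK adj_realdiag mulmxA. Qed.

Lemma herm_conj P A : A \is hermsymmx -> P *m A *m P^t* \is hermsymmx.
Proof.
by move=> /hermsymmxP Ah; apply/hermsymmxP; rewrite !adjmxM trmxCK Ah mulmxA.
Qed.

Lemma conj_udiag P d : P \is unitarymx -> P *m udiag P d *m P^t* = realdiag d.
Proof. by move=> PU; rewrite /udiag !mulmxA (unitarymxP PU) mul1mx mulmxtVK. Qed.

Lemma herm_spectral A : A \is hermsymmx ->
  exists P d, P \is unitarymx /\ A = udiag P d.
Proof.
move=> Ah; have PU := spectral_unitarymx A.
have /orthomx_spectralP := hermitian_normalmx Ah.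
have /mxOverP := hermitian_spectral_diag_real Ah.
move: (spectralmx A) (spectral_diag A) PU => P e PU e_real ->.
exists P, (map_mx (@complex.Re R) e); split; first exact: PU.
rewrite (invmx_unitary PU) /udiag.
suff -> : diag_mx e = realdiag (map_mx (@complex.Re R) e) by [].
rewrite /realdiag -map_mx_comp; congr diag_mx.
by apply/rowP => j; rewrite mxE /= RRe_real.
Qed.

Lemma mul_dotmxE m (B : 'M[R[i]]_(m, n)) A a :
  dotmx (row a B *m A) (row a B) = (B *m A *m B^t*) a a.
Proof.
rewrite dotmxE -row_mul !mxE; apply: eq_bigr => c _.
by rewrite !mxE.
Qed.

Lemma nonneg_spectral A : nonneg_op A ->
  exists P d, [/\ P \is unitarymx, A = udiag P d & forall a, 0 <= d 0 a].
Proof.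
move=> [Ah Apos]; have [P [d [PU AE]]] := herm_spectral Ah.
exists P, d; split=> // a; rewrite -ler0c.
have := Apos (row a P); rewrite mul_dotmxE AE conj_udiag // realdiagE.
by rewrite eqxx mulr1n.
Qed.

Lemma row_neq0_unitary P a : P \is unitarymx -> row a P != 0.
Proof.
move=> /row_unitarymxP/(_ a a); rewrite eqxx => Paa.
by apply/eqP => P0; move: Paa; rewrite P0 linear0l => /esym/eqP; rewrite oner_eq0.
Qed.

Lemma strictly_pos_spectral A : strictly_pos_op A ->
  exists P d, [/\ P \is unitarymx, A = udiag P d & forall a, 0 < d 0 a].
Proof.
move=> [Ah Apos]; have [P [d [PU AE]]] := herm_spectral Ah.
exists P, d; split=> // a; rewrite -ltcR.
have := Apos (row a P) (row_neq0_unitary a PU).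
by rewrite mul_dotmxE AE conj_udiag // realdiagE eqxx mulr1n.
Qed.

(** In eigenbasis coordinates [w], the form is the sum of the non-negative terms [d_j |w_j|^2]; if
    it vanishes, so does each [d_j w_j]. *)
Lemma nonneg_form_eq0 A (u : 'rV[R[i]]_n) : nonneg_op A ->
  dotmx (u *m A) u = 0 -> u *m A = 0.
Proof.
move=> /nonneg_spectral[P [d [PU -> d0]]]; rewrite dotmxE.
set w := u *m P^t*; have -> : u *m udiag P d = w *m realdiag d *m P.
  by rewrite /udiag /w !mulmxA.
have -> : w *m realdiag d *m P *m u^t* = w *m realdiag d *m w^t*.
  by rewrite /w adjmxM trmxCK !mulmxA.
rewrite mxE => /eqP; rewrite psumr_eq0 => [/allP w0|j _]; last first.
  rewrite mul_realdiagr !mxE mulrAC mulr_ge0 ?mul_conjC_ge0 //.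
  by rewrite ler0c.
suff -> : w *m realdiag d = 0 by rewrite mul0mx.
apply/rowP => j; rewrite mul_realdiagr mxE.
have := w0 j (mem_index_enum _); rewrite mul_realdiagr !mxE /= mulf_eq0 conjC_eq0.
by case/orP => /eqP // ->; rewrite mul0r.
Qed.

(** Diagonalizing [A], the trace is the sum of the values of the form of [B] at the rows of
    [P *m L], with positive weights [d_a]. If it vanishes, every row of [P *m L *m B] is zero, and
    [P] is invertible. *)
Lemma trace_sandwich_ge0 A B L : strictly_pos_op A -> nonneg_op B ->
  0 <= \tr (A *m (L *m B *m L^t*)) /\
  (\tr (A *m (L *m B *m L^t*)) = 0 -> L *m B = 0).
Proof.
move=> /strictly_pos_spectral[P [d [PU -> d0]]] Bpos.
have dterm a : 0 <= dotmx (row a (P *m L) *m B) (row a (P *m L)).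
  exact: Bpos.2.
have -> : \tr (udiag P d *m (L *m B *m L^t*)) =
    \sum_a (d 0 a)%:C * dotmx (row a (P *m L) *m B) (row a (P *m L)).
  rewrite /udiag -!mulmxA mxtrace_mulC -mulmxA; apply: eq_bigr => a _.
  rewrite mul_realdiagl; congr (_ * _).
  by rewrite mul_dotmxE adjmxM !mulmxA.
have ge0 a : 0 <= (d 0 a)%:C * dotmx (row a (P *m L) *m B) (row a (P *m L)).
  by rewrite mulr_ge0 // ler0c ltW.
split; first by apply: sumr_ge0 => a _; exact: ge0.
move=> /eqP; rewrite psumr_eq0 => [/allP all0|//].
rewrite -[L *m B](mulKmx (unitarymx_unit PU)) (mulmxA P).
suff -> : P *m L *m B = 0 by rewrite mulmx0.
apply/row_matrixP => a; rewrite row0 row_mul.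
apply: nonneg_form_eq0 => //; apply/eqP.
have := all0 a (mem_index_enum _); rewrite mulf_eq0 => /orP[/eqP/complexI da0|//].
by have := d0 a; rewrite da0 ltxx.
Qed.

(** In the eigenbasis of [A] the equation reads [(d_a + d_b) K_ab = 2 B'_ab], and
    [d_a + d_b > 0]. *)
Lemma lyapunov_solution A B : strictly_pos_op A -> B \is hermsymmx ->
  exists L, L \is hermsymmx /\ B = 2^-1 *: (A *m L + L *m A).
Proof.
move=> /strictly_pos_spectral[P [d [PU AE d0]]] Bh.
pose B' := P *m B *m P^t*.
pose K : 'M[R[i]]_n := \matrix_(a, b) (2 / (d 0 a + d 0 b)%:C * B' a b).
have B'h : B' \is hermsymmx by exact: herm_conj.
exists (P^t* *m K *m P); split.
  rewrite -[X in _ *m _ *m X]trmxCK; apply: herm_conj.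
  apply/hermsymmxP/matrixP => a b; rewrite !mxE.
  move: (hermsymmxP _ B'h) => /matrixP/(_ a b); rewrite !mxE => <-.
  rewrite rmorphM /= addrC; congr (_ * _).
  rewrite [LHS]fmorph_div /= -[X in _ / X]/(conjc _) conjc_real.
  by rewrite -[X in X / _]/(conjc _) conjc_nat.
rewrite AE; apply: lyapunov_uconj PU _; apply/matrixP => a b.
rewrite mxE mul_realdiagl mul_realdiagr [RHS]mxE -/B' mxE.
have dn0 : (d 0 a + d 0 b)%:C != 0 :> R[i].
  by rewrite fmorph_eq0 gt_eqF ?addr_gt0.
rewrite [_ * (d 0 b)%:C]mulrC -mulrDl -rmorphD /=.
by rewrite mulrA mulrCA divff // mulr1.
Qed.

End UnitaryDiagonal.

(** * Simultaneous unitary diagonalization of commuting self-adjoint matrices *)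

Section Codiagonalization.
Variables (C : numClosedFieldType) (n : nat).
Implicit Types (A B P : 'M[C]_n) (e : 'rV[C]_n).

Lemma eigenvalue_uconj P e c : P \is unitarymx ->
  reflect (exists a, c = e 0 a) (eigenvalue (P^t* *m diag_mx e *m P) c).
Proof.
move=> PU; apply: (iffP eigenvalueP) => [[v vE v0]|[a ->]].
  have wE : v *m P^t* *m diag_mx e = c *: (v *m P^t*).
    by rewrite scalemxAl -vE !mulmxA mulmxtVK.
  have /rV0Pn[j wj0] : v *m P^t* != 0.
    by apply: contraNneq v0 => w0; rewrite -(mulmxKtV v PU) // w0 mul0mx.
  exists j; apply: (mulIf wj0); have /rowP/(_ j) := wE.
  by rewrite mul_mx_diag !mxE mulrC.
exists (row a P); last first.
  apply/eqP => P0; have /row_unitarymxP/(_ a a) := PU.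
  by rewrite P0 linear0l eqxx => /esym/eqP; rewrite oner_eq0.
rewrite -row_mul !mulmxA (unitarymxP PU) mul1mx row_mul.
suff -> : row a (diag_mx e) = e 0 a *: delta_mx 0 a by rewrite -scalemxAl -rowE.
by apply/rowP => j; rewrite !mxE eqxx /= eq_sym mulr_natr.
Qed.

(** A projection is determined by its values on the rows of [P]. Distinct eigenvalues make row [a]
    span the eigenspace, so row [a] is fixed and the other rows, orthogonal to it, are sent to
    zero. *)
Lemma proj_ortho_eigenspace_uconj P e a : P \is unitarymx ->
  injective (e 0) ->
  proj_ortho (eigenspace (P^t* *m diag_mx e *m P) (e 0 a)) =
  P^t* *m delta_mx a a *m P.
Proof.
move=> PU e_inj; set X := _ *m _ *m _; set E := eigenspace _ _.
have PX b : row b P *m X = e 0 b *: row b P.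
  rewrite -row_mul !mulmxA (unitarymxP PU) mul1mx row_mul.
  by apply/rowP => j; rewrite -row_mul mul_diag_mx !mxE.
suff PE : P *m proj_ortho E = delta_mx a a *m P.
  by rewrite -mulmxA -PE mulmxA (mulmx1C (unitarymxP PU)) mul1mx.
apply/row_matrixP => b; rewrite !row_mul.
have -> : row b (delta_mx a a) = (b == a)%:R *: delta_mx 0 a :> 'rV[C]_n.
  by apply/rowP => j; rewrite !mxE eqxx /= -natrM mulnb.
rewrite -scalemxAl -rowE; case: (eqVneq b a) => [->|ba].
  by rewrite scale1r proj_ortho_id //; apply/eigenspaceP; rewrite PX.
rewrite scale0r proj_ortho_0 //; apply/orthomx1P.
have EX : E *m X = e 0 a *: E by apply/eigenspaceP; exact: submx_refl.
have : E *m P^t* *m diag_mx e = e 0 a *: (E *m P^t*).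
  by rewrite scalemxAl -EX !mulmxA mulmxtVK.
move=> /matrixP EPe; apply/rowP => i; rewrite [RHS]mxE.
(* Coordinate [b] of an eigenvector for [e_a] is annihilated by [e_b - e_a], which is nonzero. *)
have : (E *m P^t*) i b * (e 0 b - e 0 a) = 0.
  have := EPe i b; rewrite mul_mx_diag mxE [RHS]mxE mulrBr => ->.
  by rewrite mulrC subrr.
move=> /eqP; rewrite mulf_eq0 subr_eq0 (inj_eq e_inj) (negbTE ba) orbF => /eqP EP0.
have -> : row b P *m E^t* = row b ((E *m P^t*)^t*).
  by rewrite (adjmxM E) trmxCK row_mul.
by rewrite mxE mxE [X in Num.conj X]mxE EP0 conjC0.
Qed.

(* [cotrigonalization] only handles finite families; a finite spanning
   subfamily is enough. *)
Lemma max_span_subfamily (F : set 'M[C]_n) : exists r : seq 'M[C]_n,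
  (forall A, A \in r -> F A) /\ (forall A, F A -> A \in span r).
Proof.
pose P := fun m : nat =>
  `[< exists r : seq 'M[C]_n, (forall A, A \in r -> F A) /\ \dim (span r) = m >].
have exP : exists m, P m.
  by exists (\dim (span ([::] : seq 'M[C]_n))); apply/asboolP; exists [::].
have ubP m : P m -> (m <= \dim (fullv : {vspace 'M[C]_n}))%N.
  by move=> /asboolP[r [_ <-]]; apply: dimvS; exact: subvf.
case: (ex_maxnP exP ubP) => m /asboolP[r [rF sm]] m_max.
exists r; split=> // A FA.
have : (\dim (span (A :: r)) <= m)%N.
  apply: m_max; apply/asboolP; exists (A :: r); split=> // B.
  by rewrite inE => /orP[/eqP->|/rF].
have rAr : (span r <= span (A :: r))%VS by rewrite span_cons addvSr.
rewrite -sm => le_dim.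
have /eqP -> : span r == span (A :: r).
  by rewrite -(dimv_leqif_eq rAr) eqn_leq dimvS.
by rewrite memv_span // mem_head.
Qed.

(** A triangular matrix equal to its conjugate transpose is diagonal. *)
Lemma is_diag_uconj P A : A \is hermsymmx -> is_trig_mx (P *m A *m P^t*) ->
  is_diag_mx (P *m A *m P^t*).
Proof.
move=> /is_hermitianmxP; rewrite expr0 scale1r => Ah /is_trig_mxP At.
apply/is_diag_mxP => i j; rewrite neq_ltn => /orP[|ji]; first exact: At.
have -> : P *m A *m P^t* = (P *m A *m P^t*)^t*.
  by rewrite !adjmxM trmxCK -Ah mulmxA.
by rewrite mxE mxE At // conjC0.
Qed.

(** A common unitary triangularizes a finite spanning subfamily; self-adjointness turns triangular
    into diagonal, and being diagonal passes to linear combinations. *)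
Lemma herm_codiagonalization (F : set 'M[C]_n) :
  (forall A, F A -> A \is hermsymmx) ->
  (forall A B, F A -> F B -> A *m B = B *m A) ->
  exists2 P : 'M[C]_n, P \is unitarymx &
    forall A, F A -> is_diag_mx (P *m A *m P^t*).
Proof.
move=> Fh Fc; have [s [sF Fs]] := max_span_subfamily F.
have [|P PU /allP sP] := @cotrigonalization C n s.
  by move=> A B /sF FA /sF FB; exact: Fc.
exists P => // A FA; rewrite (@coord_span _ _ _ (in_tuple s) A (Fs _ FA)).
apply/is_diag_mxP => i j ij; rewrite mulmx_sumr mulmx_suml summxE big1 // => k _.
rewrite -scalemxAr -scalemxAl mxE.
have sk : s`_k \in s by exact: mem_nth.
have := sP _ sk; rewrite /= /similar_to /= conjymx //.
by move=> /(is_diag_uconj (Fh _ (sF _ sk)))/is_diag_mxP ->; rewrite ?mulr0.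
Qed.

End Codiagonalization.

Lemma Re_realM (R : realType) (x : R) (z : R[i]) :
  complex.Re (x%:C * z) = x * complex.Re z.
Proof. by case: z => a b /=; rewrite mul0r subr0. Qed.

Lemma Im_realM (R : realType) (x : R) (z : R[i]) :
  complex.Im (x%:C * z) = x * complex.Im z.
Proof. by case: z => a b /=; rewrite mul0r addr0. Qed.

(** * Functional calculus and exponential in a unitary eigenbasis *)

Section FunctionalCalculus.
Variables (R : realType) (n : nat).
Implicit Types (A B L P : 'M[R[i]]_n) (d e : 'rV[R]_n).

Lemma herm_udiag_family (F : set 'M[R[i]]_n) :
  (forall A, F A -> A \is hermsymmx) ->
  (forall A B, F A -> F B -> A *m B = B *m A) ->
  exists2 P, P \is unitarymx & forall A, F A -> exists d, A = udiag P d.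
Proof.
move=> Fh Fc; have [P PU PF] := herm_codiagonalization Fh Fc.
exists P => // A FA; exists (\row_a complex.Re ((P *m A *m P^t*) a a)).
rewrite -[LHS](uconjK A PU).
have /hermsymmxP := herm_conj P (Fh _ FA).
have /is_diag_mxP := PF A FA.
move: (P *m A *m P^t*) => B Bd Bh; congr (_ *m _ *m _).
apply/matrixP => a b; rewrite realdiagE mxE.
case: (eqVneq a b) => [->|ab]; last by rewrite mulr0n Bd.
rewrite mulr1n RRe_real // CrealE; apply/eqP.
by move: Bh => /matrixP/(_ b b); rewrite !mxE.
Qed.

(** For unitary [P], the orthogonal projection onto the line spanned by row [a] of [P]. *)
Definition uproj P (a : 'I_n) : 'M[R[i]]_n := P^t* *m delta_mx a a *m P.

Lemma udiag_sum P d : udiag P d = \sum_a (d 0 a)%:C *: uproj P a.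
Proof.
rewrite /udiag /realdiag diag_mx_sum_delta mulmx_sumr mulmx_suml.
by apply: eq_bigr => a _; rewrite mxE -scalemxAr -scalemxAl.
Qed.

(** Injectivity of [d] matches the spectrum one to one with the indices, so each spectral projection
    is a single [uproj P a]. *)
Lemma op_fun_udiag (f : R -> R) P d : P \is unitarymx -> injective (d 0) ->
  op_fun f (udiag P d) = udiag P (map_mx f d).
Proof.
move=> PU d_inj; rewrite /op_fun [RHS]udiag_sum.
have e_inj : injective (map_mx (real_complex R) d 0).
  by move=> a b; rewrite !mxE => /complexI /d_inj.
have -> : [set x : R | eigenvalue (udiag P d) x%:C] = [set` codom (d 0)].
  apply/seteqP; split=> x /=.
    move=> /(eigenvalue_uconj _ _ PU)[a]; rewrite mxE => /complexI ->.
    exact: codom_f.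
  by move=> /codomP[a ->]; apply/(eigenvalue_uconj _ _ PU); exists a; rewrite mxE.
rewrite -fsbig_seq /=; last by rewrite map_inj_uniq ?enum_uniq.
rewrite big_map big_enum /=; apply: eq_bigr => a _; rewrite mxE; congr (_ *: _).
have := proj_ortho_eigenspace_uconj a PU e_inj.
by rewrite [X in eigenspace _ X]mxE.
Qed.

Lemma mul_udiag P d e : P \is unitarymx ->
  udiag P d *m udiag P e = udiag P (\row_a (d 0 a * e 0 a)).
Proof.
move=> PU; rewrite [LHS](mul_uconj _ _ PU).
suff -> : realdiag d *m realdiag e = realdiag (\row_a (d 0 a * e 0 a)) by [].
apply/matrixP => a b; rewrite mul_realdiagl !realdiagE mxE -rmorphM /=.
by rewrite mulrnAr.
Qed.

Lemma exp_udiag P d i : P \is unitarymx ->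
  udiag P d ^+ i = udiag P (map_mx (fun x => x ^+ i) d).
Proof.
move=> PU; elim: i => [|i IH].
  rewrite expr0 /udiag; have -> : realdiag (map_mx (fun x => x ^+ 0) d) = 1%:M.
    apply/matrixP => a b; rewrite realdiagE !mxE expr0.
    by rewrite rmorphMn.
  by rewrite mulmx1 (adjmx_unitary PU).
rewrite exprS IH; apply: etrans (mul_udiag _ _ PU) _; congr udiag; apply/rowP => a.
by rewrite !mxE exprS.
Qed.

(** All partial sums are diagonal in the basis [P], with partial sums of real exponential series on
    the diagonal, so convergence is scalar. *)
Lemma expmx_udiag P d : P \is unitarymx ->
  expmx (udiag P d) = udiag P (map_mx expR d).
Proof.
move=> PU; rewrite /expmx /=.
have SE N : \sum_(i < N) (i`!%:R)^-1 *: udiag P d ^+ i =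
    udiag P (\row_a series (exp_coeff (d 0 a)) N).
  rewrite (eq_bigr (fun i : 'I_N => \sum_a
      (d 0 a ^+ i / i`!%:R)%:C *: uproj P a)) => [|i _].
    rewrite exchange_big udiag_sum; apply: eq_bigr => a _.
    by rewrite -scaler_suml -rmorph_sum mxE seriesEord.
  rewrite exp_udiag // udiag_sum scaler_sumr; apply: eq_bigr => a _.
  rewrite scalerA mxE; congr (_ *: _).
  by rewrite rmorphM /= fmorphV /= rmorph_nat mulrC.
(* [e] is real, so real and imaginary parts are linear in it and only the coefficients [e 0 a] pass
   to the limit. *)
have remxE e : remx (udiag P e) = \sum_a e 0 a *: remx (uproj P a).
  apply/matrixP => i j; rewrite udiag_sum !mxE !summxE raddf_sum /=.
  by apply: eq_bigr => a _; rewrite !mxE Re_realM.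
have immxE e : immx (udiag P e) = \sum_a e 0 a *: immx (uproj P a).
  apply/matrixP => i j; rewrite udiag_sum !mxE !summxE raddf_sum /=.
  by apply: eq_bigr => a _; rewrite !mxE Im_realM.
under eq_fun do rewrite SE.
under [X in cplxmx _ (limn X)]eq_fun do rewrite SE.
have lim_sum (G : 'I_n -> 'M[R]_n) :
  (fun N => \sum_a (\row_a series (exp_coeff (d 0 a)) N) 0 a *: G a) @ \oo -->
  \sum_a (map_mx expR d) 0 a *: G a.
  apply: cvg_big => [|a _]; first exact: add_continuous.
  under eq_fun do rewrite mxE.
  rewrite mxE; apply: cvgZr_tmp; exact: is_cvg_series_exp_coeff.
have -> : limn (fun N => remx (udiag P (\row_a series (exp_coeff (d 0 a)) N))) =
    remx (udiag P (map_mx expR d)).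
  rewrite remxE; apply/cvg_lim => //; under eq_fun do rewrite remxE.
  exact: lim_sum.
have -> : limn (fun N => immx (udiag P (\row_a series (exp_coeff (d 0 a)) N))) =
    immx (udiag P (map_mx expR d)).
  rewrite immxE; apply/cvg_lim => //; under eq_fun do rewrite immxE.
  exact: lim_sum.
apply/matrixP => a b; rewrite mxE [X in X +i* _]mxE [X in _ +i* X]mxE.
by case: (udiag _ _ _ _).
Qed.

End FunctionalCalculus.

(** * Measurements attaining the quantum information *)

(** The middle term is grouped as the right side of the score equation, so for a score [L] it is a
    derivative of the state [A]. *)
Lemma shift_sandwich (F : numFieldType) n (A L : 'M[F]_n) c :
  (L - c%:M) *m (A *m (L - c%:M)) =
  L *m A *m L + (- (2 * c)) *: (2^-1 *: (A *m L + L *m A)) + (c * c) *: A.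
Proof.
rewrite scalerA mulNr mulrAC divff ?mul1r ?pnatr_eq0 // scaleNr scalerDr opprD.
rewrite mulmxBl mul_scalar_mx [A *m (_ - _)]mulmxBr mul_mx_scalar mulmxBr.
rewrite -scalemxAr scalerBr scalerA mulmxA opprB !addrA -!addrA; congr (_ + _).
by rewrite addrA addrC.
Qed.

Lemma shift_mulmx_eq0 (F : numFieldType) n (A L : 'M[F]_n) c :
  (L - c%:M) *m A = 0 -> L *m A = c *: A.
Proof. by rewrite mulmxBl mul_scalar_mx => /eqP; rewrite subr_eq0 => /eqP. Qed.

Lemma mxtrace_delta (F : pzRingType) n (A : 'M[F]_n) a b :
  \tr (delta_mx b a *m A) = A a b.
Proof.
rewrite /mxtrace (bigD1 b) //= big1 ?addr0 => [|c cb].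
  rewrite mxE (bigD1 a) //= big1 ?addr0 => [|e ea].
    by rewrite mxE !eqxx mul1r.
  by rewrite mxE (negbTE ea) andbF mul0r.
by rewrite mxE big1 // => e _; rewrite mxE (negbTE cb) mul0r.
Qed.

(** Reduces the trace to real products of entries, the form in which integrals and derivatives are
    taken. *)
Lemma Re_trM (R : realType) n (A B : 'M[R[i]]_n) : complex.Re (\tr (A *m B)) =
  \sum_a \sum_b (remx A a b * remx B b a - immx A a b * immx B b a).
Proof.
rewrite /mxtrace raddf_sum; apply: eq_bigr => a _.
rewrite mxE raddf_sum; apply: eq_bigr => b _; rewrite !mxE.
by case: (A a b) (B b a) => ? ? [? ?].
Qed.

Section Measure.
Context (d : measure_display) (T : measurableType d) (R : realType).
Variable nu : {measure set T -> \bar R}.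

Lemma integrable_EFin_sum (I : Type) (r : seq I) (h : I -> T -> R) :
  (forall i, nu.-integrable setT (EFin \o h i)) ->
  nu.-integrable setT (EFin \o fun x => \sum_(i <- r) h i x).
Proof.
move=> ih; rewrite (_ : _ \o _ = fun x => (\sum_(i <- r) (h i x)%:E)%E).
  by apply: integrable_sum => // i _; exact: ih.
by apply/funext => x; rewrite /= sumEFin.
Qed.

Lemma Rintegral_sum (I : Type) (r : seq I) (h : I -> T -> R) :
  (forall i, nu.-integrable setT (EFin \o h i)) ->
  \int[nu]_x (\sum_(i <- r) h i x) = \sum_(i <- r) \int[nu]_x h i x.
Proof.
move=> ih; elim: r => [|i r IH].
  under eq_Rintegral do rewrite big_nil.
  by rewrite big_nil Rintegral_cst // mul0r.
under eq_Rintegral do rewrite big_cons.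
by rewrite big_cons RintegralD ?IH //; exact: integrable_EFin_sum.
Qed.

Lemma ae_eq0_of_Rintegral_eq0 (f : T -> R) : nu.-integrable setT (EFin \o f) ->
  (forall x, 0 <= f x) -> \int[nu]_x f x = 0 -> {ae nu, forall x, f x = 0}.
Proof.
move=> fi f0 If0; have mf := measurable_int nu fi.
have /(ae_eq_integral_abs nu measurableT mf) : (\int[nu]_x `|(f x)%:E|)%E = 0%E.
  rewrite (eq_integral (EFin \o f)) => [|x _]; last by rewrite gee0_abs ?lee_fin.
  by rewrite -[LHS]fineK ?integrable_fin_num // -[fine _]/(\int[nu]_x f x) If0.
by apply: filterS => x /(_ I) [].
Qed.

Lemma Rintegral_ae_eq0 (f : T -> R) : nu.-integrable setT (EFin \o f) ->
  {ae nu, forall x, f x = 0} -> \int[nu]_x f x = 0.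
Proof.
move=> fi f0; rewrite /Rintegral (ae_eq_integral (cst 0%E)) //.
- by rewrite integral_cst // mul0e.
- exact: measurable_int fi.
- by apply: filterS f0 => x /= ->.
Qed.

End Measure.

Section ResolutionOfIdentity.
Context (d : measure_display) (T : measurableType d) (R : realType) (n : nat).
Variables (nu : {measure set T -> \bar R}) (m : T -> 'M[R[i]]_n).
Hypothesis m_ge0 : forall x, nonneg_op (m x).
Hypothesis m_int : forall a b,
  nu.-integrable setT (fun x => (remx (m x) a b)%:E) /\
  nu.-integrable setT (fun x => (immx (m x) a b)%:E).
Hypothesis m_one : cplxmx (\matrix_(a, b) \int[nu]_x remx (m x) a b)
  (\matrix_(a, b) \int[nu]_x immx (m x) a b) = 1%:M.
Implicit Types A L : 'M[R[i]]_n.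

(** For a state [A] this is the density of the outcome; by linearity in [A], derivatives of the
    state give derivatives of the density. *)
Definition retr A x : R := complex.Re (\tr (A *m m x)).

Let term_int A a b : nu.-integrable setT (EFin \o
  fun x => remx A a b * remx (m x) b a - immx A a b * immx (m x) b a).
Proof.
have [re im] := m_int b a.
apply: (@integrableB _ _ _ _ _ measurableT
  (fun x => (remx A a b * remx (m x) b a)%:E)
  (fun x => (immx A a b * immx (m x) b a)%:E)).
- exact: (integrableZl measurableT _ re).
- exact: (integrableZl measurableT _ im).
Qed.

Lemma integrable_retr A : nu.-integrable setT (EFin \o retr A).
Proof.
rewrite (_ : retr A = fun x => \sum_a \sum_b
    (remx A a b * remx (m x) b a - immx A a b * immx (m x) b a)).
  by apply: integrable_EFin_sum => a; apply: integrable_EFin_sum => b.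
by apply/funext => x; rewrite /retr Re_trM.
Qed.

Lemma measurable_retr A : measurable_fun setT (retr A).
Proof. exact/measurable_EFinP/(measurable_int nu)/integrable_retr. Qed.

(** The integral of [m] is the identity, and the trace is linear. *)
Lemma Rintegral_retr A : \int[nu]_x retr A x = complex.Re (\tr A).
Proof.
rewrite -[A in RHS]mulmx1 -m_one Re_trM.
under eq_Rintegral do rewrite /retr Re_trM.
rewrite Rintegral_sum => [|a]; last by apply: integrable_EFin_sum => b.
apply: eq_bigr => a _; rewrite Rintegral_sum //; apply: eq_bigr => b _.
have [re im] := m_int b a.
rewrite RintegralB //.
- by rewrite !RintegralZl // !mxE.
- exact: (integrableZl measurableT _ re).
- exact: (integrableZl measurableT _ im).
Qed.

Lemma retrD A B x : retr (A + B) x = retr A x + retr B x.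
Proof. by rewrite /retr mulmxDl mxtraceD raddfD. Qed.

Lemma retrZ (c : R) A x : retr (c%:C *: A) x = c * retr A x.
Proof. by rewrite /retr -scalemxAl mxtraceZ Re_realM. Qed.

Section Score.
Variables rho L : 'M[R[i]]_n.
Hypotheses (rho_pos : strictly_pos_op rho) (L_herm : L \is hermsymmx).
Let p x := retr rho x.
Let dp x := retr (2^-1 *: (rho *m L + L *m rho)) x.
(** Where [p x = 0] the inverse is 0, so [l x = 0]; there [m x = 0] as well. *)
Let l x := (p x)^-1 * dp x.
(** The pointwise information gap: when [L] is a score, its integral is the quantum information
    minus the Fisher information. *)
Let w x := retr (L *m rho *m L) x - l x * l x * p x.

(** The sandwich by the identity: strict positivity of [rho] lets the density vanish only where
    [m x] does. *)
Let p_ge0 x : 0 <= p x /\ (p x = 0 -> m x = 0).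
Proof.
have [] := trace_sandwich_ge0 1%:M rho_pos (m_ge0 x).
rewrite !mul1mx trmx1 map_mx1 mulmx1 => t0 tm.
rewrite /p /retr; move: t0 tm; case: (\tr _) => a b; rewrite lecE /=.
by move=> /andP[/eqP -> a0] tm; split=> // a00; apply: tm; rewrite a00.
Qed.

Let retr_sandwich (c : R) x :
  complex.Re (\tr (rho *m ((L - c%:C%:M) *m m x *m (L - c%:C%:M)^t*))) =
  retr (L *m rho *m L) x - 2 * c * dp x + c * c * p x.
Proof.
have -> : (L - c%:C%:M)^t* = L - c%:C%:M.
  rewrite linearB raddfB /= (hermsymmxP _ L_herm); congr (_ - _).
  apply/matrixP => a b; rewrite !mxE eq_sym rmorphMn /=.
  by rewrite -[X in X *+ _]/(conjc _) conjc_real.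
rewrite mulmxA mxtrace_mulC mulmxA mulmxA -/(retr _ x).
rewrite -mulNr -!retrZ -!retrD; congr (retr _ x).
rewrite rmorphN !rmorphM /= rmorph_nat; exact: shift_sandwich.
Qed.

(** The shifted sandwich is a quadratic in [c], minimal at [c = l x] when [p x > 0], with value
    [w x] there; sign and equality case come from [trace_sandwich_ge0]. *)
Let w_ge0 x : 0 <= w x /\ (w x = 0 -> L *m m x = (l x)%:C *: m x).
Proof.
have [p0 pm] := p_ge0 x.
have [px0|px0] := eqVneq (p x) 0.
  by rewrite /w px0 /retr (pm px0) !mulmx0 mxtrace0 mulr0 subr0 scaler0.
have wE : w x =
    complex.Re (\tr (rho *m ((L - (l x)%:C%:M) *m m x *m (L - (l x)%:C%:M)^t*))).
  have dpE : dp x = l x * p x by rewrite /l mulrAC mulVf // mul1r.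
  by rewrite retr_sandwich dpE /w; ring.
have [t0 tm] := trace_sandwich_ge0 (L - (l x)%:C%:M) rho_pos (m_ge0 x).
rewrite wE; move: t0 tm; case: (\tr _) => a b; rewrite lecE /=.
move=> /andP[/eqP -> a0] tm; split=> // a00.
by apply: shift_mulmx_eq0; apply: tm; rewrite a00.
Qed.

(** The non-negative gap [w] has integral zero, so it vanishes almost everywhere, and the equality
    case of [w_ge0] applies. *)
Lemma score_eigenfunction :
  \int[nu]_(x in [set x | 0 < p x]) (l x * l x * p x) =
    complex.Re (\tr (L *m rho *m L)) ->
  {ae nu, forall x, L *m m x = (l x)%:C *: m x}.
Proof.
move=> info.
(* Off the set [0 < p x] the density is zero, and so is the integrand. *)
have hE : \int[nu]_(x in [set x | 0 < p x]) (l x * l x * p x) =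
    \int[nu]_x (l x * l x * p x).
  rewrite Rintegral_mkcond; congr (Rintegral _ _ _); apply/funext => x.
  rewrite patchE; case: ifPn => //; rewrite notin_setE /= => /negP.
  rewrite -leNgt => px; have -> : p x = 0.
    by apply/eqP; rewrite eq_le px; case: (p_ge0 x).
  by rewrite mulr0.
have ml : measurable_fun setT l.
  (* Measurability of the inverse: it is a power, with agreement for all [p x >= 0], zero
     included. *)
  rewrite (_ : l = (fun x => p x `^ (-1)) \* dp); last first.
    by apply/funext => x; rewrite /= powR_inv1 //; case: (p_ge0 x).
  apply: measurable_funM; last exact: measurable_retr.
  exact: measurableT_comp (measurable_powR _) (measurable_retr _).
have h_int : nu.-integrable setT (EFin \o fun x => l x * l x * p x).
  (* Domination by the integrable [retr (L *m rho *m L)], which is what [0 <= w] says. *)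
  apply: (le_integrable measurableT _ _ (integrable_retr (L *m rho *m L))).
    apply/measurable_EFinP; apply: measurable_funM; last exact: measurable_retr.
    exact: measurable_funM.
  move=> x _ /=; rewrite lee_fin; have [w0 _] := w_ge0 x.
  have h0 : 0 <= l x * l x * p x.
    by rewrite mulr_ge0 -?expr2 ?sqr_ge0 //; case: (p_ge0 x).
  have hq : l x * l x * p x <= retr (L *m rho *m L) x by rewrite -subr_ge0.
  by rewrite !ger0_norm // (le_trans h0).
have w_int : nu.-integrable setT (EFin \o w).
  exact: (integrableB measurableT (integrable_retr (L *m rho *m L)) h_int).
have := ae_eq0_of_Rintegral_eq0 w_int (fun x => (w_ge0 x).1).
rewrite RintegralB //; last exact: integrable_retr.
rewrite Rintegral_retr -hE info subrr => /(_ erefl).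
by apply: filterS => x; case: (w_ge0 x).
Qed.

End Score.

(** Almost everywhere [L1 L2 m] and [L2 L1 m] both equal [l1 l2 m], so the commutator [C] kills [m].
    Integrating [A C m] then shows that the trace of [A C] has zero real part for every [A]. *)
Lemma comm_of_ae_eigen L1 L2 (l1 l2 : T -> R) :
  {ae nu, forall x, L1 *m m x = (l1 x)%:C *: m x} ->
  {ae nu, forall x, L2 *m m x = (l2 x)%:C *: m x} ->
  L1 *m L2 = L2 *m L1.
Proof.
move=> ae1 ae2; set C := L1 *m L2 - L2 *m L1.
suff C0 : C = 0 by apply/eqP; rewrite -subr_eq0 -/C C0.
have Cm : {ae nu, forall x, C *m m x = 0}.
  apply: filterS2 ae1 ae2 => x e1 e2.
  rewrite mulmxBl -!mulmxA e1 e2 -!scalemxAr e1 e2 !scalerA mulrC.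
  exact: subrr.
have trC A : complex.Re (\tr (A *m C)) = 0.
  rewrite -Rintegral_retr; apply: Rintegral_ae_eq0; first exact: integrable_retr.
  by apply: filterS Cm => x Cmx; rewrite /retr -mulmxA Cmx mulmx0 mxtrace0.
apply/matrixP => a b; rewrite [RHS]mxE.
(* Testing with a matrix unit and with [i] times it gives the real and the imaginary part of
   [C a b]. *)
have := trC (delta_mx b a); rewrite mxtrace_delta.
have := trC ('i%C *: delta_mx b a); rewrite -scalemxAl mxtraceZ mxtrace_delta mulrC.
by rewrite ReiNIm; case: (C a b) => u v /= /eqP; rewrite oppr_eq0 => /eqP -> ->.
Qed.

End ResolutionOfIdentity.

(** * Functions with vanishing partial derivatives *)

Section Calculus.
Variables (R : realType) (k : nat).
Implicit Types (x y v : 'rV[R]_k) (D : set 'rV[R]_k).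

Lemma derive_comp1 (g : R -> R) (f : 'rV[R]_k -> R) (dg : R) x v :
  is_derive (f x) 1 g dg -> differentiable f x ->
  differentiable (g \o f) x /\ 'D_v (g \o f) x = dg * 'D_v f x.
Proof.
move=> [dgx dgE] dfx; have dgd := (derivable1_diffP _ _).1 dgx.
have dcomp : differentiable (g \o f) x by exact: differentiable_comp.
split=> //; rewrite !deriveE // diff_comp //= diff1E // derive1E dgE.
exact: mulrC.
Qed.

Lemma derive_line (f : 'rV[R]_k -> R) x v (t : R) :
  derivable f (t *: v + x) v ->
  is_derive t 1 (fun s : R => f (s *: v + x)) ('D_v f (t *: v + x)).
Proof.
have quotE : (fun h : R => h^-1 *: (((fun s : R => f (s *: v + x)) \o shift t)
      (h *: 1) - f (t *: v + x))) =
    (fun h : R => h^-1 *: ((f \o shift (t *: v + x)) (h *: v) - f (t *: v + x))).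
  apply/funext => h /=; congr (_ *: (f _ - _)).
  by rewrite [h *: 1]mulr1 scalerDl addrA.
by move=> fd; apply: DeriveDef; rewrite /derivable /derive quotE.
Qed.

(** The ball contains the segment from [x] to [y], and the mean value theorem applies along it. *)
Lemma derive_eq0_ball (f : 'rV[R]_k -> R) x y (e : R) :
  (forall z v, ball x e z -> derivable f z v /\ 'D_v f z = 0) ->
  ball x e y -> f y = f x.
Proof.
move=> f0 xy; set v := y - x.
have lineP (t : R) : 0 <= t <= 1 -> ball x e (t *: v + x).
  move=> /andP[t0 t1]; rewrite -ball_normE /= opprD addrCA subrr addr0 normrN.
  rewrite normrZ ger0_norm //.
  apply: le_lt_trans (_ : `|v| < e); first by rewrite ler_piMl.
  by move: xy; rewrite -ball_normE /= distrC.
pose g t := f (t *: v + x).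
have gd (t : R) : 0 <= t <= 1 -> is_derive t 1 g 0.
  move=> /lineP xt; have [fd <-] := f0 _ v xt; exact: derive_line.
have [t|t|c _] := @MVT R g (fun=> 0) 0 1 ltr01.
- by rewrite in_itv /= => /andP[/ltW t0 /ltW t1]; apply: gd; rewrite t0.
- apply: derivable_within_continuous => {}t; rewrite in_itv /= => /gd [].
  by [].
- rewrite mul0r => /eqP; rewrite subr_eq0 /g scale1r scale0r add0r subrK.
  by move=> /eqP.
Qed.

(** The image of the path is connected, and the part of it where [f = f x] is nonempty, relatively
    open and relatively closed. *)
Lemma locally_constant_path (f : 'rV[R]_k -> R) D x y g :
  (forall z, D z -> \forall w \near z, D w /\ f w = f z) ->
  is_path_in D x y g -> f y = f x.
Proof.
move=> floc [g_cont g0 g1 gD].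
have conn := connected_continuous_connected (@segment_connected R 0 1) g_cont.
have imD z : [set g t | t in `[0, 1]] z -> D z.
  by move=> [t /=]; rewrite in_itv /= => /gD Dgt <-.
pose S := [set g t | t in `[0, 1]] `&` [set z | f z = f x].
have SE : S = [set g t | t in `[0, 1]].
  apply: conn.
  - exists x; split=> //; exists 0 => //; by rewrite /= in_itv /= lexx ler01.
  - exists (interior [set z | D z /\ f z = f x]); first exact: open_interior.
    rewrite /S; apply/seteqP; split=> z [zi fz]; split=> //.
      by have := floc _ (imD _ zi); apply: filterS => w; rewrite fz.
    by have := nbhs_singleton fz => -[].
  (* Local constancy puts every image point with another value in this interior, whose complement is
     closed. *)
  - exists (~` interior [set z | D z /\ f z <> f x]).
      exact/open_closedC/open_interior.
    rewrite /S; apply/seteqP; split=> z [zi fz]; split=> //.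
      by move=> /nbhs_singleton[_]; apply.
    apply: contrapT => fzx; apply: fz.
    have := floc _ (imD _ zi); apply: filterS => w [Dw fw].
    by split=> //; rewrite fw.
suff : S y by case.
by rewrite SE; exists 1 => //; rewrite /= in_itv /= lexx ler01.
Qed.

Lemma derive_partials (f : 'rV[R]_k -> R) x v : differentiable f x ->
  'D_v f x = \sum_j v 0 j * 'D_(delta_mx 0 j) f x.
Proof.
move=> df; rewrite deriveE // {1}(row_sum_delta v) linear_sum.
by apply: eq_bigr => j _; rewrite linearZ deriveE.
Qed.

(** Zero partials give zero derivatives in all directions, hence constancy on balls inside [D];
    paths carry this over [D]. *)
Lemma constant_of_partials_eq0 (f : 'rV[R]_k -> R) D :
  open D -> (forall x y, D x -> D y -> exists g, is_path_in D x y g) ->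
  (forall x, D x -> differentiable f x /\
    forall j, 'D_(delta_mx 0 j) f x = 0) ->
  forall x y, D x -> D y -> f y = f x.
Proof.
move=> openD pathD f0 x y Dx Dy; have [g gP] := pathD _ _ Dx Dy.
apply: locally_constant_path gP => z Dz.
have /nbhs_ballP[e e0 zeD] := open_nbhs_nbhs (conj openD Dz).
apply/nbhs_ballP; exists e => // w zew; split; first exact: zeD.
apply: derive_eq0_ball zew => u v /zeD /f0[fd fj]; split.
  exact: diff_derivable.
by rewrite derive_partials // big1 // => j _; rewrite fj mulr0.
Qed.

End Calculus.

Lemma remx_cplxmx (R : realType) m n (A B : 'M[R]_(m, n)) :
  remx (cplxmx A B) = A.
Proof. by apply/matrixP => a b; rewrite !mxE. Qed.

Lemma immx_cplxmx (R : realType) m n (A B : 'M[R]_(m, n)) :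
  immx (cplxmx A B) = B.
Proof. by apply/matrixP => a b; rewrite !mxE. Qed.

(** * Quantum scores *)

Section MatrixDerivative.
Variables (R : realType) (k n : nat).
Implicit Types (f : 'rV[R]_k -> 'M[R[i]]_n) (x : 'rV[R]_k) (A : 'M[R[i]]_n).

Lemma differentiable_entry (f : 'rV[R]_k -> 'M[R]_n) x a b :
  differentiable f x ->
  differentiable (fun y => f y a b) x /\
  forall v, 'D_v (fun y => f y a b) x = 'D_v f x a b.
Proof.
move=> df; split; last first.
  move=> v; have dfv : derivable f x v by exact: diff_derivable.
  by rewrite (derive_mx dfv) mxE.
apply: (@differentiable_comp _ _ _ _ f (fun N : 'M[R]_n => N a b)) => //.
exact: differentiable_coord.
Qed.

Lemma derive_Re_tr f x A : mx_differentiable f x ->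
  differentiable (fun y => complex.Re (\tr (A *m f y))) x /\
  forall j, 'D_(delta_mx 0 j) (fun y => complex.Re (\tr (A *m f y))) x =
    complex.Re (\tr (A *m mx_partial f j x)).
Proof.
move=> [dre dim].
pose h a b : 'rV[R]_k -> R := remx A a b *: (fun y => remx (f y) b a) -
  immx A a b *: (fun y => immx (f y) b a).
have -> : (fun y => complex.Re (\tr (A *m f y))) = \sum_a \sum_b h a b.
  apply/funext => y; rewrite Re_trM fct_sumE; apply: eq_bigr => a _.
  by rewrite fct_sumE.
have hre a b := differentiable_entry b a dre.
have him a b := differentiable_entry b a dim.
have dh a b : differentiable (h a b) x.
  apply: differentiableB; apply: differentiableZ; first exact: (hre a b).1.
  exact: (him a b).1.
have dhs a : differentiable (\sum_b h a b) x by exact: differentiable_sum.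
split; first exact: differentiable_sum.
move=> j; set v := delta_mx 0 j.
have hv a b : derivable (h a b) x v by exact: diff_derivable.
rewrite derive_sum => [|a]; last exact: diff_derivable.
rewrite Re_trM; apply: eq_bigr => a _; rewrite derive_sum //.
apply: eq_bigr => b _.
have dre' : derivable (fun y => remx (f y) b a) x v.
  by apply: diff_derivable; exact: (hre a b).1.
have dim' : derivable (fun y => immx (f y) b a) x v.
  by apply: diff_derivable; exact: (him a b).1.
rewrite deriveB; [|exact: derivableZ|exact: derivableZ].
rewrite deriveZ // deriveZ // (hre a b).2 (him a b).2.
by rewrite remx_cplxmx immx_cplxmx.
Qed.

(** The entry relations of self-adjointness hold on a neighbourhood of [x] because [D] is open, so
    they pass to derivatives. *)
Lemma mx_partial_herm f x j (D : set 'rV[R]_k) : open D -> D x ->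
  (forall y, D y -> f y \is hermsymmx) -> mx_differentiable f x ->
  mx_partial f j x \is hermsymmx.
Proof.
move=> openD Dx fh [dre dim]; apply/hermsymmxP/matrixP => a b.
have nearD : \forall y \near x, D y by exact: open_nbhs_nbhs.
set v : 'rV[R]_k := delta_mx 0 j.
have fE y : D y -> remx (f y) b a = remx (f y) a b /\
    immx (f y) b a = - immx (f y) a b.
  move=> /fh /hermsymmxP /matrixP /(_ b a); rewrite !mxE.
  by case: (f y a b) (f y b a) => p q [r s] /= [<- <-].
have [dab Dab] := differentiable_entry a b dim.
have DreE : 'D_v (fun y => remx (f y)) x b a = 'D_v (fun y => remx (f y)) x a b.
  rewrite -(differentiable_entry a b dre).2 -(differentiable_entry b a dre).2.
  by apply: near_eq_derive; near=> y; case: (fE y _) => //; near: y.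
have DimE : 'D_v (fun y => immx (f y)) x b a = - 'D_v (fun y => immx (f y)) x a b.
  rewrite -Dab -(differentiable_entry b a dim).2 -deriveN.
    2: exact: diff_derivable.
  by apply: near_eq_derive; near=> y; case: (fE y _) => //; near: y.
rewrite !mxE -/v DreE DimE.
by rewrite -[LHS]/(conjc _) /= opprK.
Unshelve. all: by end_near. Qed.

(** A solution exists for a strictly positive state, so the choice is a genuine solution and not the
    default. *)
Lemma qscoreP (rho : 'rV[R]_k -> 'M[R[i]]_n) j theta :
  strictly_pos_op (rho theta) -> mx_partial rho j theta \is hermsymmx ->
  is_qscore rho j theta (qscore rho j theta).
Proof.
move=> rho_pos drho; have [L LP] := lyapunov_solution rho_pos drho.
rewrite /qscore; apply: (xgetPex 0); by exists L.
Qed.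

End MatrixDerivative.

Lemma conj_lyapunov (C : numClosedFieldType) n (P A D : 'M[C]_n) :
  P \is unitarymx ->
  P *m (2^-1 *: (A *m (P^t* *m D *m P) + P^t* *m D *m P *m A)) *m P^t* =
  2^-1 *: (P *m A *m P^t* *m D + D *m (P *m A *m P^t*)).
Proof.
move=> PU; rewrite -scalemxAr -scalemxAl mulmxDr mulmxDl; congr (_ *: (_ + _)).
  by rewrite !mulmxA mulmxtVK.
by rewrite !mulmxA (unitarymxP PU) mul1mx.
Qed.

Lemma eq_of_uconj_eq (C : numClosedFieldType) n (P A B D : 'M[C]_n) :
  P \is unitarymx -> P *m A *m P^t* = D *m (P *m B *m P^t*) *m D ->
  A = P^t* *m D *m P *m B *m (P^t* *m D *m P).
Proof.
by move=> PU AB; rewrite -[LHS](uconjK A PU) AB !mulmxA.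
Qed.

Lemma mulVf_double (F : numFieldType) (x : F) : 2^-1 * (x + x) = x.
Proof. by field. Qed.

(** * Integration of the score equations in the common eigenbasis *)

Section Model.
Variables (R : realType) (n k : nat) (Theta : set 'rV[R]_k)
  (rho : 'rV[R]_k -> 'M[R[i]]_n).
Hypotheses (Theta_open : open Theta)
  (rho_diff : forall theta, Theta theta -> mx_differentiable rho theta)
  (rho_pos : forall theta, Theta theta -> strictly_pos_op (rho theta)).

Lemma qscore_spec j theta : Theta theta ->
  is_qscore rho j theta (qscore rho j theta).
Proof.
move=> Dtheta; apply: qscoreP; first exact: rho_pos.
apply: (mx_partial_herm _ Theta_open Dtheta); last exact: rho_diff.
by move=> y /rho_pos[].
Qed.

(** The diagonal entry [(j, j)] of the information equality is the hypothesis of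
    [score_eigenfunction] for the quantum score. *)
Lemma info_attained_score (d : measure_display) (T : measurableType d)
    (nu : {sigma_finite_measure set T -> \bar R}) (m : T -> 'M[R[i]]_n)
    M j theta :
  is_measurement M -> is_density nu m M -> Theta theta ->
  map_mx (real_complex R) (fisher_info nu rho m theta) = qinfo rho theta ->
  {ae nu, forall x, qscore rho j theta *m m x =
                    (score rho m j theta x)%:C *: m x}.
Proof.
move=> [_ M1 _] [m_ge0 m_int mM] Dtheta /matrixP/(_ j j) info.
have [Lh dE] := qscore_spec j Dtheta.
have m_one := mM _ measurableT; rewrite M1 in m_one.
have scoreE : score rho m j theta = fun x => (retr m (rho theta) x)^-1 *
    retr m (2^-1 *: (rho theta *m qscore rho j theta +
                     qscore rho j theta *m rho theta)) x.
  by apply/funext => x; rewrite /score dE.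
rewrite scoreE.
apply: (score_eigenfunction m_ge0 m_int (esym m_one) (rho_pos Dtheta) Lh).
move: info; rewrite !mxE scoreE => /(congr1 (@complex.Re R)) /= ->.
(* For equal indices the two traces in [qinfo] coincide, and the factor one half cancels. *)
congr complex.Re; rewrite mxtraceD; exact: mulVf_double.
Qed.

Section Rotated.
Variables (P : 'M[R[i]]_n).
Hypothesis PU : P \is unitarymx.
Variable L : 'I_k -> 'rV[R]_k -> 'rV[R]_n.
Hypothesis LP : forall j theta, Theta theta ->
  qscore rho j theta = udiag P (L j theta).

(** The factor [c] treats both parts at once: [c = 1] gives the real part, [c = i] minus the
    imaginary part. *)
Definition rotated_entry (c : R[i]) a b theta : R :=
  complex.Re (c * (P *m rho theta *m P^t*) a b).

(** Turns an entry in the basis [P] into a trace functional, to which [derive_Re_tr] applies. *)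
Lemma rotated_entryE c a b A :
  complex.Re (c * (P *m A *m P^t*) a b) =
  complex.Re (\tr ((c *: (P^t* *m delta_mx b a *m P)) *m A)).
Proof.
rewrite -scalemxAl mxtraceZ -(mxtrace_delta (P *m A *m P^t*)).
congr (complex.Re (c * _)).
by rewrite !mulmxA mxtrace_mulC !mulmxA.
Qed.

(** In the common eigenbasis the score equation decouples into one linear equation per entry. *)
Lemma derive_rotated_entry c a b theta : Theta theta ->
  differentiable (rotated_entry c a b) theta /\
  forall j, 'D_(delta_mx 0 j) (rotated_entry c a b) theta =
    2^-1 * (L j theta 0 a + L j theta 0 b) * rotated_entry c a b theta.
Proof.
move=> Dtheta.
have -> : rotated_entry c a b = fun y => complex.Re
    (\tr ((c *: (P^t* *m delta_mx b a *m P)) *m rho y)).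
  by apply/funext => y; exact: rotated_entryE.
have [df Df] := derive_Re_tr (c *: (P^t* *m delta_mx b a *m P)) (rho_diff Dtheta).
split=> // j; rewrite Df -!rotated_entryE.
have [_ ->] := qscore_spec j Dtheta; rewrite LP // conj_lyapunov //.
rewrite mxE [X in 2^-1 * X]mxE mul_realdiagl mul_realdiagr.
rewrite -Re_realM; congr complex.Re.
rewrite rmorphM rmorphD /= fmorphV rmorph_nat.
by move: (_ a b) => z; ring.
Qed.

Definition rotated_diag a := rotated_entry 1 a a.

Lemma rotated_diag_gt0 a theta : Theta theta -> 0 < rotated_diag a theta.
Proof.
move=> /rho_pos[_ pos]; have := pos _ (row_neq0_unitary a PU).
rewrite mul_dotmxE /rotated_diag /rotated_entry mul1r.
by case: (_ a a) => u v; rewrite ltcE /= => /andP[].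
Qed.

(** The case [a = b] of the entrywise equation is [d_j rho_aa = l_a rho_aa]; the logarithm is thus a
    potential for [l_a]. *)
Lemma derive_ln_rotated_diag a theta : Theta theta ->
  differentiable (fun y => ln (rotated_diag a y)) theta /\
  forall j, 'D_(delta_mx 0 j) (fun y => ln (rotated_diag a y)) theta =
    L j theta 0 a.
Proof.
move=> Dtheta; have q0 := rotated_diag_gt0 a Dtheta.
have [dq Dq] := derive_rotated_entry 1 a a Dtheta.
have dln j := derive_comp1 (delta_mx 0 j) (is_derive1_ln q0) dq.
split; first exact: (derive_comp1 0 (is_derive1_ln q0) dq).1.
move=> j; rewrite (dln j).2 Dq -/(rotated_diag a theta).
by field; rewrite gt_eqF.
Qed.

Hypothesis Theta_path : forall x y, Theta x -> Theta y ->
  exists g, is_path_in Theta x y g.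

(** [e] is the real part of [c rho_ab / sqrt (rho_aa rho_bb)]. The exponential factor contributes
    [- (l_a + l_b) / 2] to its derivative and the entry [(l_a + l_b) / 2], which cancel. *)
Lemma normalized_entry_constant c a b theta0 theta : Theta theta0 -> Theta theta ->
  let e y := expR (- 2^-1 * (ln (rotated_diag a y) + ln (rotated_diag b y))) *
             rotated_entry c a b y in
  e theta = e theta0.
Proof.
move=> D0 D1 e.
apply: (constant_of_partials_eq0 Theta_open Theta_path _ D0 D1) => y Dy.
pose u := (- 2^-1 : R) *: ((fun z => ln (rotated_diag a z)) +
                     (fun z => ln (rotated_diag b z))).
have eE : e = (expR \o u) * rotated_entry c a b by [].
have [dla Dla] := derive_ln_rotated_diag a Dy.
have [dlb Dlb] := derive_ln_rotated_diag b Dy.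
have [dg Dg] := derive_rotated_entry c a b Dy.
have dab : differentiable ((fun z => ln (rotated_diag a z)) +
    (fun z => ln (rotated_diag b z))) y by exact: differentiableD.
have du : differentiable u y by exact: differentiableZ.
have dE j := derive_comp1 (delta_mx 0 j) (is_derive_expR (u y)) du.
have dexp : differentiable (expR \o u) y.
  exact: (derive_comp1 0 (is_derive_expR (u y)) du).1.
rewrite eE; split; first exact: differentiableM.
move=> j; rewrite deriveM; [|exact: diff_derivable..].
rewrite (dE j).2 Dg deriveZ; last exact: diff_derivable.
rewrite deriveD; [|exact: diff_derivable..].
rewrite Dla Dlb /GRing.scale /=.
by move: (expR _) (rotated_entry _ _ _ _) => s t; field.
Qed.

(** Constancy of the normalized entries gives [rho_ab (theta) = s_a rho_ab (theta0) s_b], where [s_a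
    = sqrt (rho_aa (theta) / rho_aa (theta0))] are the eigenvalues of [E]. *)
Lemma rho_uconj theta0 theta : Theta theta0 -> Theta theta ->
  let E := udiag P (\row_a expR (2^-1 *
    (ln (rotated_diag a theta) - ln (rotated_diag a theta0)))) in
  rho theta = E *m rho theta0 *m E.
Proof.
move=> D0 D1 E; apply: (eq_of_uconj_eq PU); apply/matrixP => a b.
rewrite mul_realdiagr mul_realdiagl ![(\row__ _) 0 _]mxE.
set s := expR _; set t := expR _.
set A := P *m rho theta *m _; set A0 := P *m rho theta0 *m _.
have entryE c : complex.Re (c * A a b) = complex.Re (c * (s%:C * A0 a b * t%:C)).
  have -> : complex.Re (c * (s%:C * A0 a b * t%:C)) =
      s * t * complex.Re (c * A0 a b).
    rewrite -Re_realM; congr complex.Re; rewrite rmorphM.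
    by move: (A0 a b) => z; ring.
  have /= := normalized_entry_constant c a b D0 D1.
  rewrite /rotated_entry -/A -/A0 /s /t -expRD.
  move: (ln (rotated_diag a theta)) (ln (rotated_diag a theta0)) => x x0.
  move: (ln (rotated_diag b theta)) (ln (rotated_diag b theta0)) => y y0.
  (* Multiplying by the inverse of the normalizing factor at [theta] isolates the entry at
     [theta]. *)
  move=> /(congr1 ( *%R (expR (2^-1 * (x + y))))).
  rewrite !mulrA -!expRD mulNr subrr expR0 mul1r => ->.
  by congr (expR _ * _); ring.
(* The choices [c = 1] and [c = i] recover the complex entry. *)
have := entryE 1; rewrite !mul1r; have := entryE 'i%C.
rewrite [X in complex.Re X = _ -> _]mulrC [X in _ = complex.Re X -> _]mulrC !ReiNIm.
move=> /oppr_inj Im_eq Re_eq.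
by apply/eqP; rewrite eq_complex Re_eq Im_eq !eqxx.
Qed.

End Rotated.

End Model.

(** * Construction of the observable [X] and the function [F] *)

Theorem theorem4 (R : realType) (n k : nat)
    (Theta : set 'rV[R]_k) (rho : 'rV[R]_k -> 'M[R[i]]_n)
    (Theta_open : open Theta)
    (rho_state : forall theta, Theta theta -> is_state (rho theta))
    (rho_diff2 : twice_differentiable_on Theta rho)
    (info_attained :
      exists (d : measure_display) (T : measurableType d)
             (M : set T -> 'M[R[i]]_n)
             (nu : {sigma_finite_measure set T -> \bar R})
             (m : T -> 'M[R[i]]_n),
        [/\ is_measurement M, is_density nu m M &
            forall theta, Theta theta ->
              map_mx (real_complex R) (fisher_info nu rho m theta) =
              qinfo rho theta])
    (rho_pos : forall theta, Theta theta -> strictly_pos_op (rho theta))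
    (Theta_sc : simply_connected Theta)
    (theta0 : 'rV[R]_k) (Theta_theta0 : Theta theta0) :
  exists (X : 'M[R[i]]_n) (F : R -> 'rV[R]_k -> R),
    X \is hermsymmx /\
    forall theta, Theta theta ->
      rho theta = expmx (2^-1 *: op_fun (fun x => F x theta) X) *m
                  rho theta0 *m
                  expmx (2^-1 *: op_fun (fun x => F x theta) X).
Proof.
have rho_diff theta : Theta theta -> mx_differentiable rho theta.
  by move=> /rho_diff2[].
have [d [T [M [nu [m [Mm mM info]]]]]] := info_attained.
have [m_ge0 m_int MI] := mM; have [_ M1 _] := Mm.
have m_one := MI _ measurableT; rewrite M1 in m_one.
(* Scores for all parameters and indices form one family, so that a single [P] diagonalizes them
   everywhere on [Theta]. *)
pose scores := [set L | exists theta j, Theta theta /\ L = qscore rho j theta].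
have scores_herm L : scores L -> L \is hermsymmx.
  move=> [theta [j [Dth ->]]].
  by case: (qscore_spec Theta_open rho_diff rho_pos j Dth).
have scores_comm L1 L2 : scores L1 -> scores L2 -> L1 *m L2 = L2 *m L1.
  move=> [th1 [j1 [D1 ->]]] [th2 [j2 [D2 ->]]].
  have e1 := info_attained_score Theta_open rho_diff rho_pos j1 Mm mM D1.
  have e2 := info_attained_score Theta_open rho_diff rho_pos j2 Mm mM D2.
  move: e1 e2 => /(_ (info _ D1)) e1 /(_ (info _ D2)) e2.
  exact: (comm_of_ae_eigen m_int (esym m_one) e1 e2).
have [P PU Pdiag] := herm_udiag_family scores_herm scores_comm.
(* A choice of eigenvalues in the order of the rows of [P]; [xget] returns 0 where no such vector
   exists. *)
pose L j theta := xget 0 [set e | qscore rho j theta = udiag P e].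
have LP j theta : Theta theta -> qscore rho j theta = udiag P (L j theta).
  move=> Dth; have [|e eE] := Pdiag (qscore rho j theta); first by exists theta, j.
  by rewrite /L; apply: (@xgetPex _ 0 [set e | _ = udiag P e]); exists e.
pose q a theta := rotated_diag rho P a theta.
(* The eigenvalues [0, ..., n - 1] are distinct, so any real diagonal in the basis [P] is a function
   of [X]. *)
pose X := udiag P (\row_a (a : nat)%:R).
(* The sum selects the index whose eigenvalue is [x] and is 0 for other [x]; half of it is the
   logarithm of the scaling factor from [theta0] to [theta]. *)
pose F (x : R) (theta : 'rV[R]_k) : R :=
  \sum_(a < n | x == (a : nat)%:R) (ln (q a theta) - ln (q a theta0)).
exists X, F; split; first exact: herm_udiag.
move=> theta Dth.
have X_inj : injective ((\row_a (a : nat)%:R : 'rV[R]_n) 0).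
  by move=> a b; rewrite !mxE => /eqP; rewrite eqr_nat => /eqP/val_inj.
rewrite (op_fun_udiag _ PU X_inj).
have FE (a : 'I_n) : F (a : nat)%:R theta = ln (q a theta) - ln (q a theta0).
  rewrite /F (bigD1 a) //= big1 ?addr0 // => b /andP[/eqP/eqP].
  by rewrite eqr_nat eq_sym => /eqP/val_inj ->; rewrite eqxx.
have halfE e : 2^-1 *: udiag P e = udiag P (2^-1 *: e).
  rewrite !udiag_sum scaler_sumr; apply: eq_bigr => a _.
  by rewrite scalerA mxE rmorphM /= fmorphV rmorph_nat.
rewrite halfE (expmx_udiag _ PU).
have [path_conn _] := Theta_sc.
have rhoE :=
  rho_uconj Theta_open rho_diff rho_pos PU LP path_conn Theta_theta0 Dth.
rewrite {1}rhoE.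
suff -> : map_mx expR (2^-1 *: map_mx (F^~ theta) (\row_a (a : nat)%:R)) =
  \row_a expR (2^-1 * (ln (rotated_diag rho P a theta) -
                       ln (rotated_diag rho P a theta0))) by [].
by apply/rowP => a; rewrite !mxE FE.
Qed.
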